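(* Let $m\ge2$ and let $\Sigma=\{(v(x),x):x\in\mathbb R^m\}$ be an entire graph in Euclidean space $\mathbb R^{m+1}=\mathbb R\times\mathbb R^m$. If $\Sigma$ is a self-expander for the mean curvature flow and $v$ is bounded, then $\Sigma$ is a hyperplane.
   Context: The graph function $v:\mathbb R^m\to\mathbb R$ is $C^2$. $\Sigma$ is a self-expander for the mean curvature flow if there is $q\in\mathbb R^{m+1}$ such that, with $Y(\bar x)=\bar x-q$ the position vector field from $q$, one has $\overrightarrow H=Y^\perp$ along $\Sigma$, where $\overrightarrow H$ is the unnormalized mean curvature vector (trace of the second fundamental form) and $\perp$ is the orthogonal projection on the normal bundle of $\Sigma$. *)

(* Defs.v *)
From HB Require Import structures.
From mathcomp Require Import all_boot all_order all_algebra.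
From mathcomp Require Import all_classical all_reals all_analysis.
Import Order.TTheory GRing.Theory Num.Theory.
Import numFieldNormedType.Exports.

Set Implicit Arguments.
Unset Strict Implicit.
Unset Printing Implicit Defensive.

Local Open Scope ring_scope.
Local Open Scope classical_set_scope.

(* Points and vectors of R^n are row vectors 'rV[R]_n.  The library norm on
   'rV[R]_n is the sup norm: it is used only for limits, derivatives and
   continuity, where all norms agree; the Euclidean structure is [dot]. *)
Definition dot (R : realType) (n : nat) (u w : 'rV[R]_n) : R :=
  \sum_(i < n) u 0 i * w 0 i.

Definition partial (R : realType) (m : nat) (V : normedModType R)
    (i : 'I_m) (f : 'rV[R]_m -> V) (x : 'rV[R]_m) : V :=
  'D_(delta_mx 0 i) f x.

(* C^k: all partial derivatives up to order k exist and are continuous. *)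
Fixpoint Ck (R : realType) (m : nat) (k : nat) (f : 'rV[R]_m -> R) : Prop :=
  continuous f /\
  match k with
  | 0 => True
  | k'.+1 => forall i : 'I_m,
      (forall x, derivable f x (delta_mx 0 i)) /\ Ck k' (partial i f)
  end.

(* R^(m+1) = R x R^m, with the R factor as first coordinate. *)
Definition graph_map (R : realType) (m : nat) (v : 'rV[R]_m -> R)
    (x : 'rV[R]_m) : 'rV[R]_(1 + m) :=
  row_mx (v x)%:M x.

Section Immersion.
Variables (R : realType) (m n : nat) (F : 'rV[R]_m -> 'rV[R]_n).
Implicit Types (x : 'rV[R]_m) (w : 'rV[R]_n).

(* The row space of [tangent_frame x] is the tangent space at [F x]. *)
Definition tangent_frame x : 'M[R]_(m, n) :=
  \matrix_(i < m) partial i F x.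

Definition first_fundamental_form x : 'M[R]_m :=
  \matrix_(i < m, j < m) dot (partial i F x) (partial j F x).

(* The row space of this [kermx] is the set of w such that
   w *m (tangent_frame x)^T = 0, i.e. the orthogonal complement of the tangent
   space; the projection onto it is taken parallel to the tangent space. *)
Definition normal_proj x w : 'rV[R]_n :=
  w *m proj_mx (kermx (tangent_frame x)^T) <<tangent_frame x>>%MS.

(* The second fundamental form evaluated on d_i F and d_j F, i.e. the normal
   part of the Euclidean derivative of d_j F in the direction d_i F. *)
Definition second_fundamental_form (i j : 'I_m) x : 'rV[R]_n :=
  normal_proj x (partial i (partial j F) x).

(* Unnormalized: the g-trace, g^(ij) A_(ij), without a factor 1/m. *)
Definition mean_curvature_vector x : 'rV[R]_n :=
  \sum_(i < m) \sum_(j < m)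
    (invmx (first_fundamental_form x)) i j *: second_fundamental_form i j x.

Definition self_expander : Prop :=
  exists q : 'rV[R]_n, forall x,
    mean_curvature_vector x = normal_proj x (F x - q).

End Immersion.

Definition hyperplane (R : realType) (n : nat) (S : set 'rV[R]_n) : Prop :=
  exists (a : 'rV[R]_n) (c : R), a != 0 /\ S = [set p | dot a p = c].

(* Main.v *)
Require Import Defs.
From HB Require Import structures.
From mathcomp Require Import all_boot all_order all_algebra.
From mathcomp Require Import all_classical all_reals all_analysis.
From mathcomp Require Import ring lra.
Import Order.TTheory GRing.Theory Num.Theory.
Import numFieldNormedType.Exports.
Local Open Scope ring_scope.
Local Open Scope classical_set_scope.

(** Write p for the gradient of v and D2v for its Hessian.  Only the component
    of the self-expander equation along the normal field (1, - p) carries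
    information: as the projection onto the normal space does not change the
    scalar product with a normal vector, it reads, with q = (c, a),
<<
      tr D2v - p D2v p^T / (1 + |p|^2) = (v - c) - (x - a) . p
>>
    the left-hand side being g^(ij) v_ij for the induced metric
    g = 1 + p^T p ([self_expander_pde]).  The zeroth order term has the sign for
    which the maximum principle holds, so at a maximum point of v, if there were
    one, p = 0 and D2v <= 0 would give v <= c.

    Since v is only bounded, one maximizes v - e |x - a|^2 instead, which has a
    maximum point x0 for every e > 0 ([paraboloid_max]).  There p = 2 e (x0 - a)
    and D2v <= 2 e, hence v(x0) - c <= 2 e (m + |x0 - a|^2).  The term
    e |x0 - a|^2 is bounded but has to be small.  Comparing with a point x1 at
    which v is within d of its supremum S gives
<<
      v(x0) - e |x0 - a|^2 >= S - d - e |x1 - a|^2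
>>
    so once e is small depending on x1, both S - v(x0) and e |x0 - a|^2 are at
    most 2 d.  Therefore S <= c + 8 d with d arbitrary ([bounded_solution_le]).
    The equation is odd in (v, c), so the same bound for - v shows that v = c is
    constant, and the graph is a horizontal hyperplane. *)

(** * The Euclidean scalar product *)

Lemma dotDl (R : realType) n (u v w : 'rV[R]_n) :
  dot (u + v) w = dot u w + dot v w.
Proof. by rewrite /dot -big_split; apply: eq_bigr => i _; rewrite mxE mulrDl. Qed.

Lemma dotZl (R : realType) n a (u w : 'rV[R]_n) : dot (a *: u) w = a * dot u w.
Proof. by rewrite /dot big_distrr /=; apply: eq_bigr => i _; rewrite mxE mulrA. Qed.

Lemma dotC (R : realType) n (u w : 'rV[R]_n) : dot u w = dot w u.
Proof. by apply: eq_bigr => i _; rewrite mulrC. Qed.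

Lemma dotNl (R : realType) n (u w : 'rV[R]_n) : dot (- u) w = - dot u w.
Proof. by rewrite -scaleN1r dotZl mulN1r. Qed.

Lemma dotNr (R : realType) n (u w : 'rV[R]_n) : dot u (- w) = - dot u w.
Proof. by rewrite dotC dotNl dotC. Qed.

Lemma dot0l (R : realType) n (u : 'rV[R]_n) : dot 0 u = 0.
Proof. by rewrite -(scale0r 0) dotZl mul0r. Qed.

Lemma dot_sumr (R : realType) n (I : Type) (s : seq I) (u : 'rV[R]_n) (w : I -> 'rV[R]_n) :
  dot u (\sum_(i <- s) w i) = \sum_(i <- s) dot u (w i).
Proof.
elim: s => [|i s IH]; last by rewrite !big_cons -IH dotC dotDl ![dot u _]dotC.
by rewrite !big_nil dotC dot0l.
Qed.

Lemma dotE (R : realType) n (u w : 'rV[R]_n) : dot u w = (u *m w^T) 0 0.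
Proof. by rewrite mxE; apply: eq_bigr => i _; rewrite mxE. Qed.

Lemma dot_ge0 (R : realType) n (u : 'rV[R]_n) : 0 <= dot u u.
Proof. by apply: sumr_ge0 => i _; rewrite -expr2 sqr_ge0. Qed.

Lemma dot_eq0 (R : realType) n (u : 'rV[R]_n) : dot u u = 0 -> u = 0.
Proof.
move=> /psumr_eq0P u0; apply/rowP => i; rewrite mxE; apply/eqP.
by rewrite -sqrf_eq0 expr2 u0 // => j _; rewrite -expr2 sqr_ge0.
Qed.

(** The norm of row vectors is the sup norm, so coercivity of [dot] for it has
    to be recorded: the square of the largest coordinate is one of the terms. *)
Lemma norm_sqr_le_dot (R : realType) n (u : 'rV[R]_n) : `|u| ^+ 2 <= dot u u.
Proof.
have [->|u0] := eqVneq u 0; first by rewrite normr0 expr0n dot_ge0.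
have /mx_norm_neq0 [[i j] E] : mx_norm u != 0.
  by apply: contra_neq u0; exact: mx_norm_eq0.
rewrite [X in X ^+ 2]E /= ord1 real_normK ?num_real // /dot (bigD1 j) //= expr2.
by rewrite lerDl; apply: sumr_ge0 => k _; rewrite -expr2 sqr_ge0.
Qed.

Lemma dot_row_mx (R : realType) m n (a c : 'rV[R]_m) (b d : 'rV[R]_n) :
  dot (row_mx a b) (row_mx c d) = dot a c + dot b d.
Proof.
rewrite /dot big_split_ord /=; congr (_ + _); apply: eq_bigr => i _.
  by rewrite !row_mxEl.
by rewrite !row_mxEr.
Qed.

Lemma dot_scalar (R : realType) (a b : R) : dot (a%:M : 'rV_1) b%:M = a * b.
Proof. by rewrite /dot big_ord1 !mxE !mulr1n. Qed.

(** * Directional derivatives and contact with paraboloids *)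

Lemma scaleRE (R : realType) (a b : R) : a *: b = a * b.
Proof. by []. Qed.

Lemma is_derive_line (R : realType) (V : normedModType R) (f : V -> R)
    (x v : V) (t d : R) :
  is_derive (x + t *: v) v f d -> is_derive t 1 (fun s => f (x + s *: v)) d.
Proof.
have E : (fun h : R => h^-1 *: (((fun s => f (x + s *: v)) \o shift t) (h *: (1 : R)) - f (x + t *: v)))
   = (fun h : R => h^-1 *: ((f \o shift (x + t *: v)) (h *: v) - f (x + t *: v))).
  apply/funext => h /=; congr (_ *: (f _ - _)).
  by rewrite scaleRE mulr1 scalerDl addrCA.
move=> [df <-]; split.
  by rewrite /derivable E.
by rewrite /derive E.
Qed.

(** Mean value theorem on the segment between 0 and b, whatever the sign of b. *)
Lemma mean_value_from0 (R : realType) (g dg : R -> R) (b : R) :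
  (forall t : R, is_derive t 1 g (dg t)) ->
  exists2 s, `|s| <= `|b| & g b - g 0 = dg s * b.
Proof.
move=> gd.
have gc (A : set R) : {within A, continuous g}.
  apply: continuous_subspaceT => t.
  by apply: differentiable_continuous; apply/derivable1_diffP; case: (gd t).
have [b0|b0] := leP 0 b.
  have [s sb E] := MVT_segment b0 (fun t _ => gd t) (gc _).
  exists s; last by rewrite E subr0.
  by move: sb; rewrite in_itv /= => /andP[s0 sb]; rewrite !ger0_norm.
have [s sb E] := MVT_segment (ltW b0) (fun t _ => gd t) (gc _).
exists s; last by rewrite -opprB E sub0r mulrN opprK.
move: sb; rewrite in_itv /= => /andP[sb s0].
by rewrite !ler0_norm ?lerN2 // ltW.
Qed.

(** Directional derivatives add up as soon as one of the two directions has a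
    continuous derivative: moving by h a and then by h c e, the first increment
    is handled by the derivative along a at x, the second by the mean value
    theorem along e, whose intermediate points tend to x. *)
Lemma is_derive_addZ (R : realType) (V : normedModType R) (f : V -> R)
    (x a e : V) (c da : R) :
  is_derive x a f da ->
  (forall y, derivable f y e) ->
  {for x, continuous (fun y => 'D_e f y)} ->
  is_derive x (a + c *: e) f (da + c * 'D_e f x).
Proof.
move=> [fa <-] fe ec.
suff H : h^-1 *: ((f \o shift x) (h *: (a + c *: e)) - f x) @[h --> 0^'] -->
    'D_a f x + c * 'D_e f x.
  split; first by apply/cvg_ex; exists ('D_a f x + c * 'D_e f x).
  exact: cvg_lim H.
have E : (fun h => h^-1 *: ((f \o shift x) (h *: (a + c *: e)) - f x)) =
   (fun h => h^-1 *: ((f \o shift x) (h *: a) - f x) +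
     h^-1 *: (f ((h *: a + x) + (h * c) *: e) - f (h *: a + x))).
  apply/funext => h /=; rewrite -scalerDr; congr (_ *: _).
  by rewrite scalerDr scalerA addrAC; ring.
rewrite E; apply: cvgD; first exact: fa.
apply/cvgrPdist_le => r r0.
have c1 : 0 < `|c| + 1 by rewrite ltr_wpDl.
have /cvgrPdist_le /(_ (r / (`|c| + 1))) := ec.
move=> /(_ (divr_gt0 r0 c1)) /nbhs_ballP [d /= d0 dP].
have K0 : 0 < `|a| + `|c| * `|e| + 1 by rewrite ltr_wpDl // addr_ge0 // mulr_ge0.
near=> h.
have h0 : h != 0 by near: h; exact: nbhs_dnbhs_neq.
have hd : `|h| < d / (`|a| + `|c| * `|e| + 1).
  by near: h; apply: dnbhs0_lt; rewrite divr_gt0.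
have gd (t : R) : is_derive t 1 (fun s => f ((h *: a + x) + s *: e))
    ('D_e f ((h *: a + x) + t *: e)).
  exact: is_derive_line (derivableP (fe _)).
have [s sh] := mean_value_from0 _ _ _ (h * c) gd.
rewrite scale0r addr0 => ->.
have -> : c * 'D_e f x - h^-1 *: ('D_e f (h *: a + x + s *: e) * (h * c)) =
    c * ('D_e f x - 'D_e f (h *: a + x + s *: e)).
  by rewrite scaleRE; move: h0 => /eqP h0; field; apply/eqP.
rewrite normrM.
have xb : ball x d (h *: a + x + s *: e).
  rewrite -ball_normE /ball_ /= addrAC opprD addrCA subrr addr0 normrN.
  apply: le_lt_trans (ler_normD _ _) _; rewrite !normrZ.
  move: hd; rewrite ltr_pdivlMr //; apply: le_lt_trans.
  rewrite normrM in sh.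
  have := ler_wpM2r (normr_ge0 e) sh.
  have := normr_ge0 h; nra.
have := dP _ xb.
rewrite ler_pdivlMr //.
have := normr_ge0 c.
have := normr_ge0 ('D_e f x - 'D_e f (h *: a + x + s *: e)).
nra.
Unshelve. all: by end_near. Qed.

(** Moving along one coordinate at a time reduces the derivative along any b to
    the partial derivatives. *)
Lemma is_derive_continuous_partials (R : realType) (m : nat) (f : 'rV[R]_m -> R)
    (x b : 'rV[R]_m) :
  (forall i y, derivable f y (delta_mx 0 i)) ->
  (forall i, continuous (partial i f)) ->
  is_derive x b f (dot b (\row_i partial i f x)).
Proof.
move=> fd fc.
have -> : dot b (\row_i partial i f x) = \sum_i b 0 i * partial i f x.
  by apply: eq_bigr => i _; rewrite mxE.
rewrite [b in is_derive _ b]row_sum_delta.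
elim: (index_enum _) => [|i s IH].
  by rewrite !big_nil; exact: is_derive0.
rewrite !big_cons addrC [X in is_derive _ _ _ X]addrC.
by apply: is_derive_addZ => // y; exact: fc.
Qed.

(** First and second order conditions for g to be touched from above at 0 by a
    parabola.  If the difference h had h''(0) > 0, then h' would be positive on
    some ]0, r[ because h'(0) = 0, and h would exceed its maximum h(0) there. *)
Lemma second_derivative_le (R : realType) (g dg : R -> R) (b c d : R) :
  (forall t : R, is_derive t 1 g (dg t)) -> is_derive (0 : R) 1 dg d ->
  (forall t, g t <= g 0 + b * t + c * t ^+ 2) ->
  dg 0 = b /\ d <= 2 * c.
Proof.
move=> gd dgd gle.
pose h t := g t - (b * t + c * t ^+ 2).
pose dh t := dg t - (b + 2 * c * t).
have hd (t : R) : is_derive t 1 h (dh t).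
  have pd : is_derive t 1 (fun t : R => b * t + c * t ^+ 2) (b + 2 * c * t).
    by apply: is_derive_eq; rewrite !scaleRE; ring.
  exact: is_deriveB.
have dhd : is_derive (0 : R) 1 dh (d - 2 * c).
  have pd : is_derive (0 : R) 1 (fun t : R => b + 2 * c * t) (2 * c).
    by apply: is_derive_eq; rewrite !scaleRE; ring.
  exact: is_deriveB.
have hmax t : h t <= h 0.
  rewrite /h mulr0 expr0n mulr0 addr0 subr0; have := gle t; lra.
have dh0 : dh 0 = 0.
  have m0 : is_derive (0 : R) 1 h 0.
    apply: (@derive1_at_max R h (-1) 1 0) => [|t _||t _].
    - lra.
    - by case: (hd t).
    - by rewrite in_itv /= ltrN10 ltr01.
    - exact: hmax.
  have <- : 'D_1 h 0 = dh 0 by case: (hd 0).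
  by case: m0.
split; first by move: dh0; rewrite /dh mulr0 addr0 => /eqP; rewrite subr_eq0 => /eqP.
rewrite -subr_le0 leNgt; apply/negP => d0.
case: dhd => dhdr dhE.
have : k^-1 *: ((dh \o shift 0) (k *: 1) - dh 0) @[k --> 0^'] --> d - 2 * c.
  by rewrite -dhE.
move=> /cvgrPdist_lt /(_ _ d0) /nbhs_ballP [r /= r0 rP].
have pos t : 0 < t -> t < r -> 0 < dh t.
  move=> t0 tr; have := rP t.
  rewrite -ball_normE /ball_ /= sub0r normrN gtr0_norm // => /(_ tr).
  rewrite gt_eqF // => /(_ isT).
  rewrite dh0 subr0 addr0 !scaleRE mulr1 => /ltr_normlW.
  by rewrite ltrBlDr ltrDl pmulr_rgt0 // invr_gt0.
have r2 : 0 < r / 2 by rewrite divr_gt0.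
have hc : {within `[0, r/2], continuous h}.
  apply: continuous_subspaceT => t.
  by apply: differentiable_continuous; apply/derivable1_diffP; case: (hd t).
have [s sr E] := MVT r2 (fun t _ => hd t) hc.
move: sr; rewrite in_itv /= => /andP[s0 sr].
have sp : 0 < dh s by apply: pos => //; lra.
have := hmax (r / 2).
rewrite subr0 in E.
have : 0 < dh s * (r / 2) by rewrite mulr_gt0.
lra.
Qed.

Lemma dot_sqrD (R : realType) n (z b : 'rV[R]_n) t :
  dot (z + t *: b) (z + t *: b) =
  dot z z + 2 * dot b z * t + dot b b * t ^+ 2.
Proof.
rewrite !(dotDl, dotZl) ![dot _ (z + _)]dotC !(dotDl, dotZl) [dot z b]dotC.
ring.
Qed.

(** At a maximum of v - e |. - a|^2, v lies below a paraboloid that it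
    touches at x; on each line through x this is the one-dimensional situation,
    the squared distance being a quadratic polynomial there. *)
Lemma contact_paraboloid (R : realType) (m : nat) (v : 'rV[R]_m -> R)
    (G : 'rV[R]_m -> 'rV[R]_m) (H : 'rV[R]_m -> 'M[R]_m)
    (e : R) (a x : 'rV[R]_m) :
  (forall y b, is_derive y b v (dot b (G y))) ->
  (forall y b, is_derive y b (fun z => dot b (G z)) (dot b (b *m H y))) ->
  (forall y, v y - e * dot (y - a) (y - a) <= v x - e * dot (x - a) (x - a)) ->
  G x = (2 * e) *: (x - a) /\
  forall b, dot b (b *m H x) <= 2 * e * dot b b.
Proof.
move=> dv dG vmax.
have test b : dot b (G x) = 2 * e * dot b (x - a) /\
    dot b (b *m H x) <= 2 * (e * dot b b).
  have lx : x + (0 : R) *: b = x by rewrite scale0r addr0.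
  have := @second_derivative_le R (fun t => v (x + t *: b))
    (fun t => dot b (G (x + t *: b))) (2 * e * dot b (x - a)) (e * dot b b)
    (dot b (b *m H x)).
  rewrite /= !lx; apply => [t||t]; first exact: is_derive_line.
    by apply: (@is_derive_line R _ (fun z => dot b (G z))); rewrite lx.
  have := vmax (x + t *: b); rewrite addrAC dot_sqrD; lra.
split; last by move=> b; rewrite -mulrA; case: (test b).
apply/rowP => i; have [+ _] := test (delta_mx 0 i).
by rewrite !dotE -!rowE !mxE.
Qed.

(** Outside a sup-norm ball around a, the penalty e |y - a|^2 exceeds the
    oscillation K - v a, so that the maximum over the ball is global. *)
Lemma paraboloid_max (R : realType) (m : nat) (v : 'rV[R]_m -> R) (K e : R)
    (a : 'rV[R]_m) :
  continuous v -> (forall x, v x <= K) -> 0 < e ->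
  exists x, forall y,
    v y - e * dot (y - a) (y - a) <= v x - e * dot (x - a) (x - a).
Proof.
move=> vc vK e0; set f := fun y => v y - e * dot (y - a) (y - a).
have sub_c : continuous (fun z : 'rV[R]_m => z - a).
  by move=> z; apply: (@continuousB _ _ _ id (cst a)) => //; exact: cst_continuous.
have dc : continuous (fun z : 'rV[R]_m => dot (z - a) (z - a)).
  apply: continuous_big => [|i _].
    exact: add_continuous.
  have cc z : {for z, continuous (fun z : 'rV[R]_m => (z - a) 0 i)}.
    have -> : (fun z : 'rV[R]_m => (z - a) 0 i) = (fun z => z 0 i - a 0 i).
      by apply/funext => y; rewrite !mxE.
    apply: (@continuousB _ _ _ (fun z : 'rV[R]_m => z 0 i) (cst (a 0 i))).
      exact: coord_continuous.
    exact: cst_continuous.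
  by move=> z; exact: (continuousM (cc z) (cc z)).
have fc : continuous f.
  move=> y; apply: (@continuousB _ _ _ v (fun y => e * dot (y - a) (y - a))).
    exact: vc.
  have ce : {for y, continuous (cst e : 'rV[R]_m -> R)} by exact: cst_continuous.
  exact: (continuousM ce (dc y)).
(* r >= 1 gives r <= r^2, and e r exceeds K - v a. *)
pose r := 1 + (K - v a) / e.
have r1 : 1 <= r by rewrite lerDl divr_ge0 ?subr_ge0 // ltW.
pose A := [set y | `|y - a| <= r].
have Aa : A a by rewrite /A /= subrr normr0; lra.
have Ac : compact A.
  apply: bounded_closed_compact.
    exists (r + `|a|); split; first exact: num_real.
    move=> s rs y /= yr; rewrite -[y](subrK a).
    by apply: le_trans (ler_normD _ _) _; rewrite ltW // (le_lt_trans _ rs) // lerD2r.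
  have -> : A = (fun y => `|y - a|) @^-1` [set s | s <= r] by [].
  apply: closed_comp (@closed_le _ r) => y _.
  exact: (cvg_norm (sub_c y)).
have [|x xA xmax] := @EVT_max_rV R m f A (ex_intro _ a Aa) Ac.
  exact: continuous_subspaceT.
exists x => y; have [yA|yA] := lerP `|y - a| r.
  by apply: xmax; rewrite inE.
apply: (@le_trans _ _ (f a)); last by apply: xmax; rewrite inE.
rewrite /f subrr dot0l.
have D : r <= dot (y - a) (y - a).
  apply: le_trans (norm_sqr_le_dot _ _ _).
  have : r * r <= `|y - a| * `|y - a| by apply: ler_pM; lra.
  by rewrite -expr2; nra.
have : e * r <= e * dot (y - a) (y - a) by rewrite ler_pM2l.
rewrite /r mulrDr mulrCA divff ?gt_eqF //.
have := vK y; lra.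
Qed.

(** * The maximum principle for the mean curvature operator *)

(** The sum of b M b^T over the vectors b = p_i e_j - p_j e_i is twice
    |p|^2 tr M - p M p^T, as in Lagrange's identity. *)
Lemma psd_form_le_trace (R : realType) n (M : 'M[R]_n) (p : 'rV[R]_n) :
  (forall b, 0 <= dot b (b *m M)) -> dot p (p *m M) <= dot p p * \tr M.
Proof.
move=> Mpsd.
have Q i j : 0 <= p 0 i ^+ 2 * M j j - p 0 i * p 0 j * M i j
    - p 0 i * p 0 j * M j i + p 0 j ^+ 2 * M i i.
  have := Mpsd (p 0 i *: delta_mx 0 j - p 0 j *: delta_mx 0 i).
  rewrite mulmxBl -!scalemxAl -!rowE -!scaleNr !(dotDl, dotZl).
  rewrite ![dot (delta_mx _ _) _]dotE -!rowE !mxE.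
  by rewrite !scaleRE; congr (0 <= _); ring.
have : 0 <= \sum_i \sum_j (p 0 i ^+ 2 * M j j - p 0 i * p 0 j * M i j
    - p 0 i * p 0 j * M j i + p 0 j ^+ 2 * M i i).
  by apply: sumr_ge0 => i _; apply: sumr_ge0 => j _; exact: Q.
have E1 : \sum_i \sum_j p 0 i ^+ 2 * M j j = dot p p * \tr M.
  rewrite /dot /mxtrace big_distrl; apply: eq_bigr => i _ /=.
  by rewrite big_distrr.
have E2 : \sum_i \sum_j p 0 i * p 0 j * M j i = dot p (p *m M).
  apply: eq_bigr => i _; rewrite mxE big_distrr /=.
  by apply: eq_bigr => j _; rewrite mulrA.
have E3 : \sum_i \sum_j p 0 i * p 0 j * M i j = dot p (p *m M).
  rewrite exchange_big /= -E2; apply: eq_bigr => i _; apply: eq_bigr => j _.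
  by rewrite [p 0 i * _]mulrC.
have E4 : \sum_i \sum_j p 0 j ^+ 2 * M i i = dot p p * \tr M.
  by rewrite exchange_big.
have -> : \sum_i \sum_j (p 0 i ^+ 2 * M j j - p 0 i * p 0 j * M i j
    - p 0 i * p 0 j * M j i + p 0 j ^+ 2 * M i i) =
    2 * (dot p p * \tr M - dot p (p *m M)).
  under eq_bigr do rewrite !big_split /= !sumrN.
  by rewrite !big_split /= !sumrN E1 E2 E3 E4; ring.
by rewrite pmulr_rge0 // subr_ge0.
Qed.

(** The trace of the Hessian A for the inverse of the metric 1 + p^T p induced on
    the graph, the inverse being 1 - p^T p / (1 + |p|^2). *)
Definition mc_operator {R : realType} {m : nat} (p : 'rV[R]_m) (A : 'M[R]_m) : R :=
  \tr A - (1 + dot p p)^-1 * dot p (p *m A).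

(** Ellipticity: the inverse metric lies between 0 and 1, so its trace against
    A <= c is at most c m.  With M = c - A >= 0, the bound p M p^T <= |p|^2 tr M
    keeps the rank one correction below tr M. *)
Lemma mc_operator_le (R : realType) (m : nat) (p : 'rV[R]_m) (A : 'M[R]_m) (c : R) :
  0 <= c -> (forall b, dot b (b *m A) <= c * dot b b) ->
  mc_operator p A <= c * m%:R.
Proof.
move=> c0 Ac; pose M := c%:M - A.
have ME (b : 'rV[R]_m) : dot b (b *m M) = c * dot b b - dot b (b *m A).
  rewrite /M mulmxBr mul_mx_scalar [LHS]dotC dotDl dotNl dotZl.
  by rewrite [dot (_ *m _) _]dotC.
have Mpsd b : 0 <= dot b (b *m M) by rewrite ME subr_ge0.
have := psd_form_le_trace _ _ _ p Mpsd; rewrite ME.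
have trM : \tr M = c * m%:R - \tr A.
  by rewrite /M linearB /= mxtrace_scalar mulr_natr.
have trM0 : 0 <= \tr M.
  apply: sumr_ge0 => i _; have := Mpsd (delta_mx 0 i).
  by rewrite dotE -!rowE !mxE.
have D0 : 0 < 1 + dot p p by rewrite ltr_pwDl // dot_ge0.
have pp := dot_ge0 _ _ p.
move=> key.
rewrite /mc_operator [_^-1 * _]mulrC lerBlDr -lerBlDl ler_pdivlMr //.
rewrite trM in trM0 key.
have := mulr_ge0 c0 pp; nra.
Qed.

(** The maximum principle at infinity.  With S the supremum of v and d a small
    error, choose v(x1) > S - d and e (|x1 - a|^2 + m + 1) = d.  At the maximum
    x0 of v - e |. - a|^2 both S - v(x0) and e |x0 - a|^2 are at most 2 d, and
    v(x0) - c <= 2 e m + 2 e |x0 - a|^2 <= 6 d. *)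
Lemma bounded_solution_le (R : realType) (m : nat) (v : 'rV[R]_m -> R)
    (G : 'rV[R]_m -> 'rV[R]_m) (H : 'rV[R]_m -> 'M[R]_m) (a : 'rV[R]_m) (c K : R) :
  continuous v ->
  (forall y b, is_derive y b v (dot b (G y))) ->
  (forall y b, is_derive y b (fun z => dot b (G z)) (dot b (b *m H y))) ->
  (forall x, mc_operator (G x) (H x) = v x - c - dot (x - a) (G x)) ->
  (forall x, v x <= K) ->
  forall x, v x <= c.
Proof.
move=> vc dv dG pde vK x.
have supv : has_sup (range v).
  by split; [exists (v x), x | exists K => _ [y _ <-]].
apply: (@le_trans _ _ (sup (range v))); first by apply: sup_ubound; [case: supv | exists x].
(* 8 d is the total S - c = (S - v x0) + (v x0 - c), at most 2 d + 6 d. *)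
apply/ler_addgt0Pr => d8 d80; pose d := d8 / 8.
have d0 : 0 < d by rewrite divr_gt0.
have [_ [x1 _ <-] x1d] := sup_adherent d0 supv.
pose D := dot (x1 - a) (x1 - a) + m%:R + 1.
have D1 := dot_ge0 _ _ (x1 - a).
have m0 : 0 <= m%:R :> R by [].
have D0 : 0 < D by rewrite /D; lra.
pose e := d / D.
have e0 : 0 < e by rewrite divr_gt0.
have eD : e * D = d by rewrite divfK // gt_eqF.
have [x0 x0max] := paraboloid_max _ _ _ _ _ a vc vK e0.
have [Gx0 Hx0] := contact_paraboloid _ _ _ _ _ _ _ _ dv dG x0max.
have e20 : 0 <= 2 * e by rewrite mulr_ge0 // ltW.
have := mc_operator_le _ _ (G x0) _ _ e20 Hx0; rewrite pde Gx0.
rewrite [dot _ (_ *: _)]dotC dotZl.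
have := x0max x1.
have : v x0 <= sup (range v) by apply: sup_ubound; [case: supv | exists x0].
rewrite /D in eD.
have : 0 <= e * dot (x1 - a) (x1 - a) by rewrite mulr_ge0 // ltW.
have : 0 <= e * m%:R by rewrite mulr_ge0 // ltW.
have : d8 = 8 * d by rewrite /d; lra.
nra.
Qed.

(** * The self-expander equation of a graph *)

(** A vector in the row space of T and orthogonal to it is orthogonal to itself;
    this is where positivity of [dot] is used. *)
Lemma capmx_orth (R : realType) m n (T : 'M[R]_(m, n)) :
  (kermx T^T :&: <<T>> = 0)%MS.
Proof.
apply/eqP/rowV0P => u; rewrite sub_capmx genmxE => /andP[/sub_kermxP uT /submxP[D uE]].
by apply: dot_eq0; rewrite dotE {2}uE trmx_mul mulmxA uT mul0mx mxE.
Qed.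

Lemma addsmx_orth (R : realType) m n (T : 'M[R]_(m, n)) :
  row_full (kermx T^T + <<T>>)%MS.
Proof.
rewrite /row_full mxrank_disjoint_sum ?capmx_orth // mxrank_ker mxrank_gen.
by rewrite mxrank_tr subnK // rank_leq_col.
Qed.

(** The part of w removed by the projection is tangent, so it does not pair with
    a normal vector N. *)
Lemma dot_normal_proj (R : realType) m n (F : 'rV[R]_m -> 'rV[R]_n) x
    (N w : 'rV[R]_n) :
  N *m (tangent_frame F x)^T = 0 -> dot N (normal_proj F x w) = dot N w.
Proof.
rewrite /normal_proj; set T := tangent_frame F x => NT.
have wsub : (w <= kermx T^T + <<T>>)%MS by rewrite submx_full ?addsmx_orth.
have {2}<- := add_proj_mx (capmx_orth _ _ _ T) wsub.
have /submxP[D E] : (w *m proj_mx <<T>> (kermx T^T) <= T)%MS.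
  by rewrite -(genmxE T) proj_mx_sub.
have NDT : dot N (D *m T) = 0 by rewrite dotE trmx_mul mulmxA NT mul0mx mxE.
by rewrite E [RHS]dotC dotDl [dot (D *m T) N]dotC NDT addr0 dotC.
Qed.

Lemma is_derive_graph (R : realType) (V : normedModType R) m (f : V -> R)
    (g : V -> 'rV[R]_m) (x v : V) (df : R) (dg : 'rV[R]_m) :
  is_derive x v f df -> is_derive x v g dg ->
  is_derive x v (fun y => row_mx (f y)%:M (g y) : 'rV[R]_(1 + m)) (row_mx df%:M dg).
Proof.
move=> [fd fE] [gd gE].
have L i j : (fun y => (row_mx (f y)%:M (g y) : 'rV[R]_(1 + m)) i (lshift m j)) = f.
  by apply/funext => y; rewrite row_mxEl mxE !ord1 mulr1n.
have Rr i j : (fun y => (row_mx (f y)%:M (g y) : 'rV[R]_(1 + m)) i (rshift 1 j)) = (fun y => g y i j).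
  by apply/funext => y; rewrite row_mxEr.
have D : derivable (fun y => row_mx (f y)%:M (g y) : 'rV[R]_(1 + m)) x v.
  apply/derivable_mxP => i j; case: (split_ordP j) => k ->.
    by rewrite L.
  by rewrite Rr; exact: ((derivable_mxP g x v).1 gd i k).
split=> //; rewrite derive_mx //; apply/matrixP => i j; rewrite mxE.
case: (split_ordP j) => k ->.
  by rewrite L row_mxEl mxE !ord1 mulr1n.
by rewrite Rr row_mxEr -gE derive_mx // mxE.
Qed.

Lemma partial_graph_map (R : realType) m (v : 'rV[R]_m -> R) i :
  (forall y, derivable v y (delta_mx 0 i)) ->
  partial i (graph_map v) = fun y => row_mx (partial i v y)%:M (delta_mx 0 i).
Proof.
move=> vd; apply/funext => y; rewrite /partial.
by have [_ ->] := @is_derive_graph R _ m v id y (delta_mx 0 i) _ _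
  (derivableP (vd y)) (is_derive_id _ _).
Qed.

Lemma partial2_graph_map (R : realType) m (v : 'rV[R]_m -> R) i j :
  (forall y, derivable v y (delta_mx 0 j)) ->
  (forall y, derivable (partial j v) y (delta_mx 0 i)) ->
  partial i (partial j (graph_map v)) =
  fun y => row_mx (partial i (partial j v) y)%:M 0.
Proof.
move=> vd vdd; rewrite (@partial_graph_map _ _ _ j) //.
apply/funext => y; rewrite /partial.
by have [_ ->] := @is_derive_graph R _ m (partial j v) (cst (delta_mx 0 j)) y (delta_mx 0 i) _ _
  (derivableP (vdd y)) (is_derive_cst _ _ _).
Qed.

(** The Sherman-Morrison formula. *)
Lemma invmx_rank1 (R : realType) m (p : 'rV[R]_m) :
  invmx (1%:M + p^T *m p) = 1%:M - (1 + dot p p)^-1 *: (p^T *m p).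
Proof.
have D0 : 1 + dot p p != 0 by rewrite gt_eqF // ltr_pwDl // dot_ge0.
have E : (1%:M + p^T *m p) *m (1%:M - (1 + dot p p)^-1 *: (p^T *m p)) = 1%:M.
  rewrite mulmxBr mulmx1 -scalemxAr mulmxDl mul1mx.
  have -> : p^T *m p *m (p^T *m p) = dot p p *: (p^T *m p).
    rewrite mulmxA -(mulmxA p^T) [p *m p^T]mx11_scalar -dotE.
    by rewrite mul_mx_scalar scalemxAl.
  rewrite -{2}(scale1r (p^T *m p)) -scalerDl scalerA mulVf // scale1r.
  by rewrite addrK.
have [U _] := mulmx1_unit E.
by rewrite -[RHS](mulKmx U) E mulmx1.
Qed.

Definition grad {R : realType} {m : nat} (v : 'rV[R]_m -> R) (x : 'rV[R]_m) : 'rV[R]_m :=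
  \row_i partial i v x.

Definition hess {R : realType} {m : nat} (v : 'rV[R]_m -> R) (x : 'rV[R]_m) : 'M[R]_m :=
  \matrix_(i, j) partial i (partial j v) x.

Lemma is_derive_grad (R : realType) m (v : 'rV[R]_m -> R) (x b : 'rV[R]_m) :
  Ck 2 v ->
  is_derive x b v (dot b (grad v x)) /\
  is_derive x b (fun z => dot b (grad v z)) (dot b (b *m hess v x)).
Proof.
move=> [_ vC2]; split.
  by apply: is_derive_continuous_partials => i; case: (vC2 i) => // _ [].
have dp j : is_derive x b (partial j v) (dot b (grad (partial j v) x)).
  have [_ [_ C1]] := vC2 j.
  by apply: is_derive_continuous_partials => i; case: (C1 i) => // _ [].
have -> : (fun z => dot b (grad v z)) = \sum_j (b 0 j *: partial j v).
  apply/funext => z; rewrite fct_sumE; by apply: eq_bigr => j _; rewrite mxE.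
have -> : dot b (b *m hess v x) = \sum_j b 0 j *: dot b (grad (partial j v) x).
  apply: eq_bigr => j _; rewrite scaleRE; congr (_ * _).
  by rewrite mxE; apply: eq_bigr => i _; rewrite !mxE.
apply: is_derive_sum => j; exact: is_deriveZ.
Qed.

(** Pairing the vector equation with the upward normal (1, - grad v) loses nothing
    and makes both normal projections disappear.  The second derivatives of the
    graph map are vertical, so the second fundamental form pairs to the Hessian. *)
Lemma self_expander_pde (R : realType) m (v : 'rV[R]_m -> R) :
  Ck 2 v -> self_expander (graph_map v) ->
  exists (a : 'rV[R]_m) (c : R), forall x,
    mc_operator (grad v x) (hess v x) = v x - c - dot (x - a) (grad v x).
Proof.
move=> [_ vC2] [q qE].
have vd i y : derivable v y (delta_mx 0 i) by case: (vC2 i).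
have vdd i j y : derivable (partial j v) y (delta_mx 0 i).
  by case: (vC2 j) => _ [_ /(_ i) []].
exists (rsubmx (q : 'rV[R]_(1 + m))), ((lsubmx (q : 'rV[R]_(1 + m))) 0 0) => x.
(* The upward normal, not normalized. *)
pose N : 'rV[R]_(1 + m) := row_mx 1%:M (- grad v x).
have T i : partial i (graph_map v) x = row_mx (partial i v x)%:M (delta_mx 0 i).
  by rewrite partial_graph_map.
(* Entry i pairs N with d_i F = (d_i v, e_i). *)
have NT : N *m (tangent_frame (graph_map v) x)^T = 0.
  apply/rowP => i; rewrite [RHS]mxE.
  have -> : (N *m (tangent_frame (graph_map v) x)^T) 0 i =
     dot N (partial i (graph_map v) x).
    by rewrite mxE; apply: eq_bigr => k _; rewrite !mxE.
  rewrite T dot_row_mx dot_scalar dotNl dotC dotE -rowE !mxE; ring.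
have gE : first_fundamental_form (graph_map v) x = 1%:M + (grad v x)^T *m grad v x.
  apply/matrixP => i j; rewrite mxE !T dot_row_mx dot_scalar dotE -rowE !mxE.
  by rewrite big_ord1 !mxE addrC eq_sym.
have := congr1 (dot N) (qE x).
rewrite (dot_normal_proj _ _ _ _ _ _ _ NT) /mean_curvature_vector gE invmx_rank1.
have -> : dot N (graph_map v x - q) = v x - (lsubmx (q : 'rV[R]_(1 + m))) 0 0 -
    dot (x - rsubmx (q : 'rV[R]_(1 + m))) (grad v x).
  rewrite -[q in LHS](@hsubmxK _ 1 1 m) /graph_map opp_row_mx add_row_mx.
  rewrite [lsubmx q in LHS]mx11_scalar -raddfB dot_row_mx dot_scalar dotNl mul1r.
  by rewrite [dot (grad _ _) _]dotC.
move=> <-.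
have A i j : dot N (second_fundamental_form (graph_map v) i j x) = hess v x i j.
  rewrite /second_fundamental_form dot_normal_proj // partial2_graph_map //.
  rewrite dot_row_mx dot_scalar mul1r mxE.
  by rewrite [dot _ 0]dotC dot0l addr0.
rewrite dot_sumr /mc_operator.
transitivity (\sum_i \sum_j ((i == j)%:R - (1 + dot (grad v x) (grad v x))^-1 *
   (grad v x 0 i * grad v x 0 j)) * hess v x i j); last first.
  apply: eq_bigr => i _; rewrite dot_sumr; apply: eq_bigr => j _.
  by rewrite dotC dotZl [dot _ N]dotC A !mxE big_ord1 !mxE.
set k := _^-1; set p := grad v x; set H := hess v x.
(* Split the Kronecker delta, which gives the trace, from the rank one part. *)
transitivity (\sum_i (H i i - k * \sum_j (p 0 i * p 0 j * H i j))); last first.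
  apply: eq_bigr => i _; under [RHS]eq_bigr do rewrite mulrBl.
  rewrite big_split /= sumrN; congr (_ - _).
    rewrite (bigD1 i) //= eqxx mul1r big1 ?addr0 // => j ji.
    by rewrite eq_sym (negbTE ji) mul0r.
  by rewrite big_distrr /=; apply: eq_bigr => j _; rewrite mulrA.
rewrite big_split /= sumrN -big_distrr /=; congr (_ - _ * _).
rewrite [RHS]exchange_big /=; apply: eq_bigr => j _; rewrite [X in _ * X]mxE big_distrr /=.
by apply: eq_bigr => i _; ring.
Qed.

(** * Bounded entire self-expanders *)

Theorem theorem5p23 (R : realType) (m : nat) (hm : (2 <= m)%N)
    (v : 'rV[R]_m -> R) (v_C2 : Ck 2 v)
    (v_expander : self_expander (graph_map v))
    (v_bounded : bounded_fun v) :
  hyperplane (range (graph_map v)).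
Proof.
have [a [c pde]] := self_expander_pde _ _ _ v_C2 v_expander.
have vc : continuous v by case: v_C2.
have dv y b : is_derive y b v (dot b (grad v y)).
  by case: (is_derive_grad R m v y b v_C2).
have dG y b : is_derive y b (fun z => dot b (grad v z)) (dot b (b *m hess v y)).
  by case: (is_derive_grad R m v y b v_C2).
have [K vK] : exists K, forall x, `|v x| <= K.
  have [M [_ MP]] := v_bounded; exists (M + 1) => x.
  by apply: (MP (M + 1)) => //; rewrite ltrDl.
have vle x : v x <= c.
  apply: (bounded_solution_le _ _ _ _ _ _ _ K vc dv dG pde) => y.
  by apply: le_trans (vK y); exact: ler_norm.
have vge x : c <= v x.
  rewrite -lerN2; move: x.
  apply: (bounded_solution_le _ _ (fun x => - v x) (fun x => - grad v x)
    (fun x => - hess v x) a _ K).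
  - by move=> x; exact: (continuousN (vc x)).
  - by move=> y b; rewrite dotNr; exact: is_deriveN.
  - move=> y b; rewrite mulmxN dotNr.
    have -> : (fun z => dot b (- grad v z)) = - (fun z => dot b (grad v z)).
      by apply/funext => z; rewrite dotNr.
    exact: is_deriveN.
  - move=> x; have := pde x; rewrite /mc_operator linearN /=.
    rewrite mulmxN mulNmx !(dotNl, dotNr) !opprK; lra.
  - by move=> x; apply: le_trans (vK x); rewrite -normrN ler_norm.
have vE x : v x = c by apply/eqP; rewrite eq_le vle vge.
exists (row_mx 1%:M 0 : 'rV[R]_(1 + m)), c; split.
  apply/eqP => /rowP /(_ (lshift m 0)); rewrite row_mxEl !mxE => /eqP.
  by rewrite oner_eq0.
have E (u : 'rV[R]_(1 + m)) : dot (row_mx 1%:M 0 : 'rV[R]_(1 + m)) u = lsubmx u 0 0.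
  rewrite -[u in LHS]hsubmxK [lsubmx u in LHS]mx11_scalar dot_row_mx dot_scalar.
  by rewrite mul1r dot0l addr0.
apply/seteqP; split=> [_ [x _ <-]|u] /=.
  by rewrite E /graph_map row_mxKl vE mxE.
rewrite E => uc; exists (rsubmx (u : 'rV[R]_(1 + m))) => //.
by rewrite /graph_map vE -uc -mx11_scalar hsubmxK.
Qed.
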